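(* Let $I$ be a finite subset of $\mathbb{N}\setminus\{0,1\}$ that is $\mathbb{N}$-independent and can be enumerated by a modular-convex sequence $(n_k)_{k\in\{0,\dots,r\}}$ of positive integers such that $n_0$ and $n_1$ are coprime. Denote $(d_i)_{i\in\{1,\dots,r-1\}}$ the sequence of integers such that for all $i\in\{1,\dots,r-1\}$, $d_i\geqslant 2$ and $n_{i+1}=d_in_i-n_{i-1}$. (i) Let $\rho$ and $\nu$ be integers with $\rho>r$ and $\nu<0$. Let $(d_i)_{i\in\{\nu+1,\dots,\rho-1\}}$ be an extension of $(d_i)_{i\in\{1,\dots,r-1\}}$ by integers at least $2$, which defines (via $n_{i+1}=d_in_i-n_{i-1}$) an extension of $(n_i)_{i\in\{0,\dots,r\}}$ to a modular-convex sequence $(n_i)_{i\in\{\nu,\dots,\rho\}}$ with $n_i>0$ for all $i$. Let $d$ and $m$ be the coprime positive integers such that $\frac{d}{m}=\lceil d_{\nu+1},\dots,d_{\rho-1}\rceil$, and for $i\in\{\nu+1,\dots,\rho-1\}$ let $\frac{q_i}{p_i}$ be the reduced fraction of $\lceil d_{\nu+1},d_{\nu+2},\dots,d_i\rceil$, with moreover $q_{\nu-1}=0$, $q_\nu=1$, $p_{\nu-1}=-1$, $p_\nu=0$. Put $a=n_\nu$, $b=dn_{\nu+1}-mn_\nu$ and $x_i=mq_{i-1}-dp_{i-1}$ for all $i\in\{\nu,\dots,\rho\}$. Then $n_\rho=b$ and $$\begin{cases}\gcd(a,b)=1\\ a\leqslant q_r\\ a<b<d\\ x_0<x_r+b\leqslant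 x_{-1}\end{cases}\ \Longrightarrow\ \mathrm{Irr}\left(\frac{\langle a,b\rangle}{d}\right)=I.$$ (ii) All triplets $(a,b,d)$ of pairwise coprime positive integers such that $\mathrm{Irr}\left(\frac{\langle a,b\rangle}{d}\right)=I$ and $a<b<d$ are obtained as in (i). (iii) There are infinitely many triplets $(a,b,d)$ of pairwise coprime positive integers such that $\mathrm{Irr}\left(\frac{\langle a,b\rangle}{d}\right)=I$ and $a<b<d$, obtained as in (i) with $\nu=-1$ and $\rho=r+1$.
   Context: For coprime positive integers $a,b$, $\langle a,b\rangle$ is the numerical semigroup $\{xa+yb: x,y\in\mathbb{N}\}$, and for a positive integer $d$, $\frac{\langle a,b\rangle}{d}=\{x\in\mathbb{N}: dx\in\langle a,b\rangle\}$. $\mathrm{Irr}(S)$ denotes the set of irreducible elements (minimal generators) of a numerical semigroup $S$. A set $A\subset\mathbb{N}$ is $\mathbb{N}$-independent if no $x\in A$ belongs to the submonoid generated by $A\setminus\{x\}$. A sequence $(u_i)$ is modular-convex if for every interior index $i$ there is an integer $c_i\geqslant 0$ with $u_{i-1}+u_{i+1}-2u_i=c_iu_i$. The ceiling continued fraction is defined recursively by $\lceil d_0\rceil=d_0$ and $\lceil d_0,d_1,\dots,d_i\rceil=d_0-\frac{1}{\lceil d_1,\dots,d_i\rceil}$.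
   Formalization: In (ii), each triplet is obtained as in (i) from some modular-convex enumeration of I with coprime first two terms, not necessarily the fixed one; with a fixed enumeration (ii) fails, e.g. I={2,3} enumerated as (3,2) and (a,b,d)=(3,4,5). *)

(* Defs.v *)
From mathcomp Require Export all_boot all_order all_algebra.
From mathcomp Require Export boolp classical_sets functions cardinality.
From mathcomp Require Export set_interval.

Set Implicit Arguments.
Unset Strict Implicit.
Unset Printing Implicit Defensive.

Import Order.TTheory GRing.Theory Num.Theory.

Local Open Scope classical_set_scope.
Local Open Scope ring_scope.

Definition semigroup2 (a b : nat) : set nat :=
  [set n | exists x y : nat, n = (x * a + y * b)%N].

Definition semigroup_quot (S : set nat) (d : nat) : set nat :=
  [set x | S (d * x)%N].

Definition Irr (S : set nat) : set nat :=
  [set x | [/\ S x, x <> 0%N &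
    forall y z, S y -> S z -> x = (y + z)%N -> y = 0%N \/ z = 0%N]].

Definition submonoid (M : set nat) : Prop :=
  M 0%N /\ forall x y, M x -> M y -> M (x + y)%N.

Definition N_independent (A : set nat) : Prop :=
  forall x, A x -> ~ smallest submonoid (A `\ x) x.

(* Finite sequences indexed by an interval {lo, ..., hi} of integers are
   represented by functions int -> int; values outside the interval are
   irrelevant. *)
Definition modular_convex (lo hi : int) (u : int -> int) : Prop :=
  forall i, lo < i < hi ->
    exists2 c : int, 0 <= c & u (i - 1) + u (i + 1) - 2 * u i = c * u i.

(* The value on the empty list is junk. *)
Fixpoint ceil_cf (s : seq int) : rat :=
  match s with
  | [::] => 0
  | [:: d0] => d0%:~R
  | d0 :: s' => d0%:~R - 1 / ceil_cf s'
  end.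

(* [D_(nu+1), ..., D_i], for i > nu *)
Definition cf_segment (D : int -> int) (nu i : int) : rat :=
  ceil_cf [seq D (nu + 1 + k%:Z) | k <- iota 0 (absz (i - nu))].

(* numq and denq give the reduced fraction, with positive denominator. *)
Definition cf_q (D : int -> int) (nu i : int) : int :=
  if i == nu - 1 then 0 else if i == nu then 1 else numq (cf_segment D nu i).

Definition cf_p (D : int -> int) (nu i : int) : int :=
  if i == nu - 1 then -1 else if i == nu then 0 else denq (cf_segment D nu i).

Definition ext_d (D : int -> int) (nu rho : int) : int :=
  numq (cf_segment D nu (rho - 1)).

Definition ext_m (D : int -> int) (nu rho : int) : int :=
  denq (cf_segment D nu (rho - 1)).

Definition ext_a (N : int -> int) (nu : int) : int := N nu.

Definition ext_b (D N : int -> int) (nu rho : int) : int :=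
  ext_d D nu rho * N (nu + 1) - ext_m D nu rho * N nu.

Definition ext_x (D : int -> int) (nu rho i : int) : int :=
  ext_m D nu rho * cf_q D nu (i - 1) - ext_d D nu rho * cf_p D nu (i - 1).

(* 0 < r because the coprimality condition refers to n_1. *)
Definition mc_enumeration (I : set nat) (r : nat) (n : int -> int) : Prop :=
  [/\ (0 < r)%N,
      set_bij [set i : int | 0 <= i <= r%:Z] [set k%:Z | k in I] n,
      forall i : int, 0 <= i <= r%:Z -> 0 < n i,
      modular_convex 0 r%:Z n
    & gcdz (n 0) (n 1) = 1].

Definition recurrence (lo hi : int) (n d : int -> int) : Prop :=
  forall i, lo < i < hi -> 2 <= d i /\ n (i + 1) = d i * n i - n (i - 1).

Definition extension (r : nat) (n d : int -> int) (nu rho : int)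
    (N D : int -> int) : Prop :=
  [/\ forall i : int, 0 < i < r%:Z -> D i = d i,
      forall i : int, 0 <= i <= r%:Z -> N i = n i,
      recurrence nu rho N D,
      modular_convex nu rho N
    & forall i, nu <= i <= rho -> 0 < N i].

Definition criterion (r : nat) (nu rho : int) (N D : int -> int) : Prop :=
  let a := ext_a N nu in
  let b := ext_b D N nu rho in
  let x := ext_x D nu rho in
  [/\ gcdz a b = 1,
      a <= cf_q D nu r%:Z,
      a < b < ext_d D nu rho
    & x 0 < x r%:Z + b <= x (-1)].

Definition obtained (r : nat) (n d : int -> int) (nu rho : int)
    (a b c : nat) : Prop :=
  exists N D : int -> int,
    [/\ extension r n d nu rho N D,
        criterion r nu rho N D
      & [/\ a%:Z = ext_a N nu, b%:Z = ext_b D N nu rho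
          & c%:Z = ext_d D nu rho]].

Definition is_solution (I : set nat) (a b c : nat) : Prop :=
  [/\ [/\ (0 < a)%N, (0 < b)%N & (0 < c)%N],
      [/\ coprime a b, coprime a c & coprime b c],
      (a < b < c)%N
    & Irr (semigroup_quot (semigroup2 a b) c) = I].

(* Main.v *)
Require Import Defs.
From mathcomp Require Import all_boot all_order all_algebra.
From mathcomp Require Import boolp classical_sets functions cardinality.
From mathcomp Require Import zify ring.
Import Order.TTheory GRing.Theory Num.Theory.
Local Open Scope classical_set_scope.
Local Open Scope ring_scope.

(* Shift indices so that nu = 0 and rho = L. The points (x_j, q_(j-1)),
   0 <= j <= L, run from (d, 0) to (0, d); consecutive ones form a basis of the
   lattice u = m v mod d, which is {(u, v) | d divides u a + v b}, and every
   nonzero lattice point of the quadrant dominates one of them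
   [fan_dominates]. As d n_j = x_j a + q_(j-1) b, all representations
   d n = u a + v b of an irreducible n of <a,b>/d are such points [irr_point];
   they differ by multiples of (b, -a).

   (i) The inequalities let one choose the representation of an irreducible
   element so that its index lies between those of n_0 and n_r; equality with I
   then follows from independence.
   (ii) Expand d/m with m a = -b mod d, let t be the largest index >= 1 of an
   irreducible element with q_(t-1) <= a, and s the smallest index >= 1 of one
   with x_s < x_t + b. Every nonzero element of the semigroup then has a
   representation (u, v) with u >= x_t and v >= q_(s-1); applying this to
   the elements of index s - 1, t + 1 and s, ..., t gives the inequalities and
   the irreducibility.
   (iii) With nu = -1 and rho = r + 1 the criterion reads a < b < d, m <= b and
   gcd(a, b) = 1. It holds for infinitely many large D_r once D_0 is large;
   m <= b needs n_r > K with K the numerator of [d_1, ..., d_(r-1)], which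
   comes from independence [independent_last_gt]. *)

(** * Recurrent sequences and the fan of a continued fraction *)

(* [e 0] plays no role: [e k] is the coefficient in the step from the terms
   of index [k - 1] and [k] to the term of index [k + 1]. *)
Fixpoint lrec (e : nat -> int) (u0 u1 : int) (n : nat) : int :=
  if n is n'.+1 then lrec (fun k => e k.+1) u1 (e 1%N * u1 - u0) n' else u0.

Lemma lrecSS e u0 u1 n :
  lrec e u0 u1 n.+2 = e n.+1 * lrec e u0 u1 n.+1 - lrec e u0 u1 n.
Proof. by elim: n e u0 u1 => [//|n IHn] e u0 u1; apply: IHn. Qed.

Lemma eq_lrec e e' u0 u1 n :
  (forall j, (0 < j < n)%N -> e j = e' j) -> lrec e u0 u1 n = lrec e' u0 u1 n.
Proof.
elim: n e e' u0 u1 => [//|[//|n] IHn] e e' u0 u1 ee'.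
rewrite [LHS]/= [RHS]/= (ee' 1%N) //.
by apply: (IHn (fun k => e k.+1) (fun k => e' k.+1)) => j jn; apply: ee'; lia.
Qed.

(** With [nu] moved to 0, [cfY e j] and [cfP e j] are q_(j-1) and p_(j-1), and [cfX e L j] is
    x_j. *)
Definition cfY (e : nat -> int) : nat -> int := lrec e 0 1.
Definition cfP (e : nat -> int) : nat -> int := lrec e (-1) 0.
Definition cfX (e : nat -> int) (L j : nat) : int :=
  cfP e L * cfY e j - cfY e L * cfP e j.

Lemma cfPS e j : cfP e j.+1 = cfY (fun k => e k.+1) j.
Proof. by rewrite /cfP /cfY /= mulr0 sub0r opprK. Qed.

Lemma cfYSS e j : cfY e j.+2 = e j.+1 * cfY e j.+1 - cfY e j.
Proof. exact: lrecSS. Qed.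

Lemma cfPSS e j : cfP e j.+2 = e j.+1 * cfP e j.+1 - cfP e j.
Proof. exact: lrecSS. Qed.

Lemma cfXSS e L j : cfX e L j.+2 = e j.+1 * cfX e L j.+1 - cfX e L j.
Proof. rewrite /cfX cfYSS cfPSS; ring. Qed.

(** Expansion at the left end, to match the recursion of [ceil_cf]; [lrecSS] extends at the right
    end. *)
Lemma cfY_shift e j :
  cfY e j.+1 = e 1%N * cfY (fun k => e k.+1) j - cfP (fun k => e k.+1) j.
Proof.
suff: cfY e j.+1 = e 1%N * cfY (fun k => e k.+1) j - cfP (fun k => e k.+1) j /\
      cfY e j.+2 = e 1%N * cfY (fun k => e k.+1) j.+1
                   - cfP (fun k => e k.+1) j.+1 by case.
elim: j => [|j [IH1 IH2]]; first by rewrite /cfY /cfP /=; split; ring.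
split=> //; rewrite cfYSS IH1 IH2 cfYSS cfPSS; ring.
Qed.

Lemma cf_det e j : cfP e j.+1 * cfY e j - cfP e j * cfY e j.+1 = 1.
Proof.
elim: j => [|j IHj]; first by rewrite /cfP /cfY /=; ring.
rewrite -IHj cfPSS cfYSS; ring.
Qed.

(** The recurrence is linear, and [cfY e] and [- cfP e] solve it with initial values (0, 1) and (1,
    0). *)
Lemma lrec_solution e L w :
  (forall j, (0 < j < L)%N -> w j.+1 = e j * w j - w j.-1) ->
  forall j, (j <= L)%N -> w j = cfY e j * w 1%N - cfP e j * w 0%N.
Proof.
move=> wE.
suff H : forall j, ((j <= L)%N -> w j = cfY e j * w 1%N - cfP e j * w 0%N) /\
      ((j.+1 <= L)%N -> w j.+1 = cfY e j.+1 * w 1%N - cfP e j.+1 * w 0%N).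
  by move=> j; apply: (proj1 (H j)).
elim=> [|j [IH1 IH2]]; first by rewrite /cfP /cfY /=; split=> _; ring.
split=> // jL; rewrite wE ?jL //= IH1 ?IH2; try lia.
rewrite cfYSS cfPSS; ring.
Qed.

Section Fan.
Variables (e : nat -> int) (L : nat).
Hypothesis L_gt0 : (0 < L)%N.
Hypothesis e_ge2 : forall j, (0 < j < L)%N -> 2 <= e j.

Notation Y := (cfY e).
Notation P := (cfP e).
Notation X := (cfX e L).
Notation dd := (cfY e L).
Notation m := (cfP e L).

Lemma cfY_mono1 j : (j < L)%N -> 0 <= Y j < Y j.+1.
Proof.
elim: j => [//|j IHj] jL; have /andP[Yj Yj1] := IHj (ltnW jL).
have ej := e_ge2 j.+1 jL; rewrite cfYSS; nia.
Qed.

Lemma cfY_ltn i j : (i < j <= L)%N -> Y i < Y j.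
Proof.
case/andP; elim: j => [//|j IHj] ij jL.
have /andP[_ Yj] := cfY_mono1 j jL.
case: (ltngtP i j) ij => [ij _|//|-> //]; last by lia.
by have := IHj ij (ltnW jL); lia.
Qed.

Lemma cfY_ge0 j : (j <= L)%N -> 0 <= Y j.
Proof. by case: j => [//|j] jL; have := cfY_mono1 j jL; lia. Qed.

Lemma cfY_gt0 j : (0 < j <= L)%N -> 0 < Y j.
Proof. by move=> jL; have := cfY_ltn 0%N j jL; rewrite /cfY /=. Qed.

Lemma cfX0 : X 0%N = dd.
Proof. by rewrite /cfX /cfY /cfP /=; ring. Qed.

Lemma cfX1 : X 1%N = m.
Proof. by rewrite /cfX /cfY /cfP /=; ring. Qed.

Lemma cfXL : X L = 0.
Proof. by rewrite /cfX mulrC subrr. Qed.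

Lemma cfXLp : X L.-1 = 1.
Proof.
by case: L L_gt0 => [//|l] _; rewrite /cfX /= -(cf_det e l); ring.
Qed.

Lemma cfX_mono1 j : (j < L)%N -> 0 <= X j.+1 < X j.
Proof.
(* Induction on the distance to [L]: the values known beforehand are those at [L] and [L.-1]. *)
move=> jL; have [k] : exists k, (j + k.+1 = L)%N by exists (L - j).-1; lia.
elim: k j jL => [|k IHk] j jL jk.
  have -> : j.+1 = L by lia.
  by have -> : j = L.-1; [lia | rewrite cfXL cfXLp].
have /andP[] := IHk j.+1 ltac:(lia) ltac:(lia).
have := e_ge2 j.+1 ltac:(lia); rewrite cfXSS; nia.
Qed.

Lemma cfX_ltn i j : (i < j <= L)%N -> X j < X i.
Proof.
case/andP; elim: j => [//|j IHj] ij jL.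
have /andP[_ Xj] := cfX_mono1 j jL.
case: (ltngtP i j) ij => [ij _|//|-> //]; last by lia.
by have := IHj ij (ltnW jL); lia.
Qed.

Lemma cfX_ge0 j : (j <= L)%N -> 0 <= X j.
Proof.
rewrite leq_eqVlt => /orP[/eqP->|jL]; first by rewrite cfXL.
by have := cfX_mono1 j jL; lia.
Qed.

Lemma cfX_gt0 j : (j < L)%N -> 0 < X j.
Proof. by move=> jL; have := cfX_mono1 j jL; lia. Qed.

Lemma cfX_lt i j : (i <= L)%N -> (j <= L)%N -> (X j < X i) = (i < j)%N.
Proof.
move=> iL jL; apply/idP/idP => [|ij]; last by apply: cfX_ltn; lia.
case: (ltngtP i j) => // [ji|->]; last by rewrite ltxx.
by have := cfX_ltn j i ltac:(lia); lia.
Qed.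

Lemma cfY_lt i j : (i <= L)%N -> (j <= L)%N -> (Y i < Y j) = (i < j)%N.
Proof.
move=> iL jL; apply/idP/idP => [|ij]; last by apply: cfY_ltn; lia.
case: (ltngtP i j) => // [ji|->]; last by rewrite ltxx.
by have := cfY_ltn j i ltac:(lia); lia.
Qed.

Lemma cf_dd_gt0 : 0 < dd.
Proof. by apply: cfY_gt0; lia. Qed.

Lemma cfXY_det j : X j * Y j.+1 - X j.+1 * Y j = dd.
Proof.
transitivity (dd * (P j.+1 * Y j - P j * Y j.+1)); first by rewrite /cfX; ring.
by rewrite cf_det mulr1.
Qed.

(* The cones spanned by consecutive points [(X j, Y j)] are unimodular for the
   lattice [u = m v mod dd] and cover the quadrant. *)
Lemma fan_dominates (u v : int) :
  0 <= u -> 0 <= v -> 0 < u + v -> (dd %| u - m * v)%Z ->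
  exists j, [/\ (j <= L)%N, X j <= u & Y j <= v].
Proof.
move=> u0 v0 uv /dvdzP[q uE].
have exj : exists j, (X j <= u) by exists L; rewrite cfXL.
(* The first index with X <= u places u between two consecutive abscissas; index 0 is immediate
   because Y_0 = 0. *)
case: (ex_minnP exj) => -[|j] Xj jmin.
  by exists 0%N; split=> //; rewrite /cfY.
have jL : (j < L)%N.
  rewrite ltnNge; apply/negP=> Lj.
  by have := jmin L; rewrite cfXL => /(_ u0); lia.
have uX : u < X j by rewrite ltNge; apply/negP=> /jmin; rewrite ltnn.
(* If v < Y_(j+1), take the coordinates [al], [be] of (u, v) in the basis of the points j and j + 1.
   They are integers because u = q dd + m v; [alE] and [beE] are Cramer's rule. *)
exists j.+1; split=> //; rewrite leNgt; apply/negP => vY.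
pose al := q * Y j.+1 + v * P j.+1; pose be := - (v * P j + q * Y j).
have d0 := cf_dd_gt0.
have alE : al * dd = u * Y j.+1 - v * X j.+1.
  have -> : u = q * dd + m * v by lia.
  by rewrite /al /cfX; ring.
have beE : be * dd = v * X j - u * Y j.
  have -> : u = q * dd + m * v by lia.
  by rewrite /be /cfX; ring.
have uD : u = al * X j + be * X j.+1.
  apply: (mulIf (lt0r_neq0 d0)); rewrite mulrDl -!(mulrAC _ dd) alE beE.
  by rewrite -(cfXY_det j); ring.
have vD : v = al * Y j + be * Y j.+1.
  apply: (mulIf (lt0r_neq0 d0)); rewrite mulrDl -!(mulrAC _ dd) alE beE.
  by rewrite -(cfXY_det j); ring.
have /andP[Xj0 Xjj] := cfX_mono1 j jL.
have /andP[Yj0 Yjj] := cfY_mono1 j jL.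
have al0 : 0 <= al.
  have : 0 <= al * dd by rewrite alE; nia.
  by rewrite pmulr_lge0.
clearbody al be; clear alE beE uE.
have [alz|al1] := eqVneq al 0.
  by rewrite alz in uD vD; case: (ltrgtP be 0) => hb; nia.
have be0 : be < 0 by rewrite ltNge; apply/negP => hb; nia.
(* As X_(j+1) < X_j, the bound u < X_j gives al <= -be; then Y_j < Y_(j+1) makes v negative. *)
have : al - 1 < - be by nia.
nia.
Qed.

Section Values.
Variable w : nat -> int.
Hypothesis wE : forall j, (0 < j < L)%N -> w j.+1 = e j * w j - w j.-1.

Lemma fan_last : w L = dd * w 1%N - m * w 0%N.
Proof. exact: (lrec_solution e L w wE). Qed.

Lemma fan_point j : (j <= L)%N -> dd * w j = X j * w 0%N + Y j * w L.
Proof.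
by move=> jL; rewrite fan_last (lrec_solution e L w wE j jL) /cfX; ring.
Qed.

(** Subtracting dominated points one after another writes n as a sum of values w_j. The first
    coordinate never grows, so only points with X_j <= u0 occur. *)
Lemma fan_generates (Q : int -> Prop) (u0 : int) :
  Q 0 -> (forall x y, Q x -> Q y -> Q (x + y)) ->
  (forall j, (j <= L)%N -> X j <= u0 -> Q (w j)) ->
  forall u v n : int, 0 <= u <= u0 -> 0 <= v -> (dd %| u - m * v)%Z ->
    dd * n = u * w 0%N + v * w L -> Q n.
Proof.
move=> Q0 QD Qw u v n; have [k] : exists k, absz (u + v) = k by eexists.
elim/ltn_ind: k u v n => k IHk u v n uvk u0u v0 dv E.
have d0 := cf_dd_gt0.
have [uv|uv] := lerP (u + v) 0.
  have u00 : u = 0 by lia.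
  have v00 : v = 0 by lia.
  by suff -> : n = 0 by []; rewrite u00 v00 in E; nia.
have [|j [jL Xu Yv]] := fan_dominates u v _ v0 uv dv; first by lia.
have X0 := cfX_ge0 j jL; have Y0 := cfY_ge0 j jL.
have XY : 0 < X j + Y j.
  have [j0|j0] := posnP j; first by rewrite j0 cfX0 in Y0 *; lia.
  by have := cfY_gt0 j ltac:(lia); lia.
rewrite -(subrK (w j) n); apply: QD; last by apply: Qw => //; lia.
apply: (IHk (absz ((u - X j) + (v - Y j))%R) _ (u - X j) (v - Y j)) => //.
- by lia.
- by lia.
- by lia.
- have -> : u - X j - m * (v - Y j) = (u - m * v) + P j * dd.
    by rewrite /cfX; ring.
  by rewrite rpredD ?dvdz_mull //.
- by rewrite mulrBr E fan_point //; ring.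
Qed.

End Values.

End Fan.

Lemma cf_coprime e j : coprimez (cfY e j) (cfP e j).
Proof.
apply/coprimezP; exists (cfP e j.+1, - cfY e j.+1) => /=.
by rewrite -(cf_det e j); ring.
Qed.

(** With d = [cfY e L] and m = [cfP e L], b = -m a mod d and m is prime to d, so a common factor of
    d with one of a, b divides the other. *)
Lemma coprime_last e L a b w1 : b = cfY e L * w1 - cfP e L * a ->
  coprimez a b -> coprimez a (cfY e L) /\ coprimez b (cfY e L).
Proof.
move=> bE /coprimezP[[x y] /= xy]; split; apply/coprimezP.
  by exists (x - y * cfP e L, y * w1) => /=; rewrite -xy bE; ring.
have := cf_coprime e L => /coprimezP[[z l] /= zl].
exists (y - x * l, x * (a * z + l * w1)) => /=.
rewrite -[RHS]xy -[a in RHS]mulr1 -zl bE; ring.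
Qed.

(** * Ceiling continued fractions *)

Lemma ceil_cfE (e : nat -> int) (j : nat) :
  (0 < j)%N -> (forall k, (0 < k <= j)%N -> 2 <= e k) ->
  ceil_cf [seq e k | k <- iota 1 j] = (cfY e j.+1)%:~R / (cfP e j.+1)%:~R.
Proof.
elim: j e => [//|[|j] IHj] e _ e2.
  have -> : cfY e 2 = e 1%N by rewrite /cfY /=; ring.
  have -> : cfP e 2 = 1 by rewrite /cfP /=; ring.
  by rewrite /= divr1.
pose e' k := e k.+1.
have -> : ceil_cf [seq e k | k <- iota 1 j.+2] =
          (e 1%N)%:~R - 1 / ceil_cf [seq e' k | k <- iota 1 j.+1].
  by rewrite /= (iotaDl 1 2) -map_comp.
rewrite {}IHj //; last by move=> k kj; apply: e2; lia.
rewrite div1r invf_div [cfP e _]cfPS -/e' (cfY_shift e) -/e'.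
rewrite intrB intrM mulrBl mulfK //.
rewrite intr_eq0; apply: lt0r_neq0; apply: (@cfY_gt0 e' j.+2) => //.
  by move=> k kj; apply: e2; lia.
by rewrite ltnS leqnn.
Qed.

Section Segment.
Variables (D : int -> int) (nu : int) (L : nat).
Hypothesis D_ge2 : forall k : nat, (0 < k < L)%N -> 2 <= D (nu + k%:Z).

Let e (k : nat) : int := D (nu + k%:Z).

(** The bound 1 < j avoids the empty segment, where [ceil_cf] is junk. Positivity of the denominator
    is what identifies [numq] and [denq] below. *)
Lemma cf_segmentE (j : nat) : (1 < j <= L)%N ->
  cf_segment D nu (nu + j%:Z - 1) = (cfY e j)%:~R / (cfP e j)%:~R /\
  0 < cfP e j.
Proof.
case: j => [//|[//|j]] jL; split; last first.
  rewrite cfPS; apply: (@cfY_gt0 _ j.+1) => //; last by rewrite leqnn.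
  by move=> k kj; apply: D_ge2; lia.
rewrite -(ceil_cfE e j.+1) //; last by move=> k kj; apply: D_ge2; lia.
rewrite /cf_segment; have -> : absz (nu + j.+2%:Z - 1 - nu)%R = j.+1 by lia.
rewrite (iotaDl 1 0) -map_comp; congr ceil_cf; apply: eq_map => k /=.
by rewrite /e; congr D; lia.
Qed.

Lemma cf_qE (j : nat) : (j <= L)%N -> cf_q D nu (nu + j%:Z - 1) = cfY e j.
Proof.
case: j => [|[|j]] jL; rewrite /cf_q.
- by rewrite addr0 eqxx.
- by rewrite addrK eqxx; have -> : (nu == nu - 1) = false by lia.
have -> : (nu + j.+2%:Z - 1 == nu - 1) = false by lia.
have -> : (nu + j.+2%:Z - 1 == nu) = false by lia.
have [-> P0] := cf_segmentE j.+2 jL.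
by rewrite coprimeq_num ?gtr0_sg ?mul1r //; apply: cf_coprime.
Qed.

Lemma cf_pE (j : nat) : (j <= L)%N -> cf_p D nu (nu + j%:Z - 1) = cfP e j.
Proof.
case: j => [|[|j]] jL; rewrite /cf_p.
- by rewrite addr0 eqxx.
- by rewrite addrK eqxx; have -> : (nu == nu - 1) = false by lia.
have -> : (nu + j.+2%:Z - 1 == nu - 1) = false by lia.
have -> : (nu + j.+2%:Z - 1 == nu) = false by lia.
have [-> P0] := cf_segmentE j.+2 jL.
by rewrite coprimeq_den ?gt_eqF ?gtr0_norm //; apply: cf_coprime.
Qed.

Lemma ext_dE : (1 < L)%N -> ext_d D nu (nu + L%:Z) = cfY e L.
Proof.
move=> L1; rewrite -cf_qE // /cf_q /ext_d.
have -> : (nu + L%:Z - 1 == nu - 1) = false by lia.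
by have -> : (nu + L%:Z - 1 == nu) = false by lia.
Qed.

Lemma ext_mE : (1 < L)%N -> ext_m D nu (nu + L%:Z) = cfP e L.
Proof.
move=> L1; rewrite -cf_pE // /cf_p /ext_m.
have -> : (nu + L%:Z - 1 == nu - 1) = false by lia.
by have -> : (nu + L%:Z - 1 == nu) = false by lia.
Qed.

Lemma ext_xE (j : nat) : (1 < L)%N -> (j <= L)%N ->
  ext_x D nu (nu + L%:Z) (nu + j%:Z) = cfX e L j.
Proof. by move=> L1 jL; rewrite /ext_x ext_dE // ext_mE // cf_qE // cf_pE. Qed.

End Segment.

(** Euclid's algorithm with quotients rounded up: d = q m - m' with 0 <= m' < m, and q >= 2 since m
    < d. It stops at m = 0, d = 1 with L = 1. *)
Lemma ceil_cf_expansion (m d : nat) : (m < d)%N -> coprime m d ->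
  exists (e : nat -> int) (L : nat),
    [/\ (0 < L)%N, forall j, (0 < j < L)%N -> 2 <= e j,
        cfY e L = d%:Z & cfP e L = m%:Z].
Proof.
elim/ltn_ind: m d => m IHm d md cmd.
have [m0|m0] := posnP m.
  move: cmd; rewrite m0 /coprime gcd0n => /eqP ->.
  by exists (fun=> 2), 1%N; split => // j; lia.
pose q := ((d + m.-1) %/ m)%N; pose m' := (q * m - d)%N.
have qE : (q * m = d + m')%N.
  have := leq_divM (d + m.-1) m; have := ltn_ceil (d + m.-1) m0.
  rewrite /m' -/q; lia.
have m'm : (m' < m)%N.
  have := leq_divM (d + m.-1) m; rewrite -/q; lia.
have q2 : (2 <= q)%N by nia.
have cm' : coprime m' m.
  rewrite /coprime -dvdn1 -(eqP cmd) dvdn_gcd dvdn_gcdr /=.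
  have -> : d = (q * m - m')%N by lia.
  by rewrite dvdn_sub ?dvdn_mull ?dvdn_gcdr ?dvdn_gcdl.
have [e [L [L0 e2 YE PE]]] := IHm m' m'm m m'm cm'.
pose e' k := if (k <= 1)%N then q%:Z else e k.-1.
have shE : forall u0 u1, lrec (fun k => e' k.+1) u0 u1 L = lrec e u0 u1 L.
  by move=> u0 u1; apply: eq_lrec => -[//|k] _.
exists e', L.+1; split=> //.
- by move=> [//|[|j]] jL; rewrite /e' /=; [lia | apply: e2; lia].
- rewrite cfY_shift /cfY /cfP !shE -/(cfY e L) -/(cfP e L) YE PE /e' /=; lia.
- by rewrite cfPS /cfY shE.
Qed.

(** * Quotients of a semigroup with two generators *)

(** Strong induction: a reducible element splits into two smaller nonzero elements of [S]. *)
Lemma Irr_ind (S Q : set nat) :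
  (forall n, Irr S n -> Q n) -> (forall y z, Q y -> Q z -> Q (y + z)%N) ->
  forall n, S n -> n <> 0%N -> Q n.
Proof.
move=> QI QD; elim/ltn_ind=> n IHn Sn n0.
have [/QI //|nI] := pselect (Irr S n).
have [[y [z [Sy Sz nE y0 z0]]]|no] := pselect (exists y z,
  [/\ S y, S z, n = (y + z)%N, y <> 0%N & z <> 0%N]).
  by rewrite nE; apply: QD; apply: IHn => //; lia.
case: nI; split=> // y z Sy Sz nE.
have [|y0] := eqVneq y 0%N; first by left.
have [|z0] := eqVneq z 0%N; first by right.
by case: no; exists y, z; split=> //; apply/eqP.
Qed.

Lemma semigroup_quotP (a b c n : nat) : semigroup_quot (semigroup2 a b) c n <->
  exists u v : int, [/\ 0 <= u, 0 <= v & c%:Z * n%:Z = u * a%:Z + v * b%:Z].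
Proof.
split=> [[u [v E]]|[u [v [u0 v0 E]]]].
  by exists u%:Z, v%:Z; split=> //; lia.
exists (absz u), (absz v); nia.
Qed.

Section Quotient.
Variables (e : nat -> int) (L : nat) (a b c : nat) (w : nat -> int).
Hypothesis L_gt0 : (0 < L)%N.
Hypothesis e_ge2 : forall j, (0 < j < L)%N -> 2 <= e j.
Hypothesis wE : forall j, (0 < j < L)%N -> w j.+1 = e j * w j - w j.-1.
Hypotheses (a_gt0 : (0 < a)%N) (b_gt0 : (0 < b)%N).
Hypotheses (aE : a%:Z = w 0%N) (bE : b%:Z = w L) (cE : c%:Z = cfY e L).
Hypotheses (cop_ab : coprime a b) (cop_ac : coprime a c).

Notation Y := (cfY e).
Notation X := (cfX e L).
Notation S := (semigroup_quot (semigroup2 a b) c).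

Lemma quot_c_gt0 : (0 < c)%N.
Proof. by have := cf_dd_gt0 e L L_gt0 e_ge2; rewrite -cE. Qed.

Lemma quot_b : b%:Z = c%:Z * w 1%N - cfP e L * a%:Z.
Proof. by rewrite bE cE aE; apply: fan_last. Qed.

Lemma quot_point j : (j <= L)%N -> c%:Z * w j = X j * a%:Z + Y j * b%:Z.
Proof. by move=> jL; rewrite aE bE cE; apply: fan_point. Qed.

Lemma quot_point_gt0 j : (j <= L)%N -> 0 < w j.
Proof.
move=> jL; have := quot_point j jL; have c0 := quot_c_gt0.
have := cfX_ge0 e L L_gt0 e_ge2 j jL; have := cfY_ge0 e L L_gt0 e_ge2 j jL.
have [->|j0] := posnP j.
  by have := cfX_gt0 e L L_gt0 e_ge2 0%N L_gt0; nia.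
have := cfY_gt0 e L L_gt0 e_ge2 j ltac:(lia); nia.
Qed.

(** Substituting b = c w_1 - m a gives a (u - m v) = c (n - v w_1), and a is prime to c. *)
Lemma quot_dvd (n u v : int) : c%:Z * n = u * a%:Z + v * b%:Z ->
  (cfY e L %| u - cfP e L * v)%Z.
Proof.
move=> E; rewrite -cE -(@Gauss_dvdzr _ a%:Z); last first.
  by move: cop_ac; rewrite coprime_sym.
apply/dvdzP; exists (n - v * w 1%N).
transitivity (c%:Z * n - v * c%:Z * w 1%N); last by ring.
rewrite E quot_b; ring.
Qed.

(** A fan point dominated by (u, v) splits n as w_j plus another element of the quotient, which must
    vanish by irreducibility. *)
Lemma irr_point n (u v : int) : Irr S n -> 0 <= u -> 0 <= v ->
  c%:Z * n%:Z = u * a%:Z + v * b%:Z ->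
  exists j, [/\ (j <= L)%N, n%:Z = w j, u = X j & v = Y j].
Proof.
move=> [Sn n0 nI] u0 v0 E; have c0 := quot_c_gt0.
have uv : 0 < u + v by nia.
have [j [jL Xu Yv]] :=
  fan_dominates e L L_gt0 e_ge2 u v u0 v0 uv (quot_dvd _ _ _ E).
have wj := quot_point j jL; have wj0 := quot_point_gt0 j jL.
have X0 := cfX_ge0 e L L_gt0 e_ge2 j jL.
have Y0 := cfY_ge0 e L L_gt0 e_ge2 j jL.
have rE : c%:Z * (n%:Z - w j) = (u - X j) * a%:Z + (v - Y j) * b%:Z.
  by rewrite mulrBr E wj; ring.
have r0 : 0 <= n%:Z - w j by rewrite -(@pmulr_rge0 _ c%:Z) // rE; nia.
have rz : n%:Z = w j.
  have [] := nI (absz (w j)) (absz (n%:Z - w j)%R); try lia.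
  - by apply/semigroup_quotP; exists (X j), (Y j); split=> //; rewrite -wj; lia.
  - by apply/semigroup_quotP; exists (u - X j), (v - Y j); split; lia.
exists j; split=> //; move: rE; rewrite rz subrr mulr0; nia.
Qed.

Lemma quot_shift (u v u' v' : int) :
  u * a%:Z + v * b%:Z = u' * a%:Z + v' * b%:Z ->
  exists k, u' = u - k * b%:Z /\ v' = v + k * a%:Z.
Proof.
move=> E.
have : (a%:Z %| v' - v)%Z.
  rewrite -(@Gauss_dvdzr _ b%:Z) //; apply/dvdzP; exists (u - u').
  by rewrite mulrBr mulrBl; lia.
by case/dvdzP=> k kE; exists k; split; nia.
Qed.

(** Shift the representation so that u lies in [X_(s-1) - b, X_(s-1)). If v remains nonnegative, the
    bounds on u place the index in [s, t], since X_t <= X_(s-1) - b. *)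
Lemma irr_window s t n :
  (0 < s <= t)%N -> (t < L)%N -> a%:Z <= Y t.+1 -> X t + b%:Z <= X s.-1 ->
  Irr S n -> exists j, (s <= j <= t)%N /\ n%:Z = w j.
Proof.
move=> st tL aY bX nI; have c0 := quot_c_gt0.
have [Sn _ _] := nI.
have [u [v [u0 v0 E]]] := proj1 (semigroup_quotP a b c n) Sn.
have sL : (s.-1 <= L)%N by lia.
pose k := ((u - (X s.-1 - b%:Z)) %/ b%:Z)%Z.
have kE := divz_eq (u - (X s.-1 - b%:Z)) b%:Z; rewrite -/k in kE.
have r0 := @modz_ge0 (u - (X s.-1 - b%:Z)) b%:Z ltac:(lia).
have rb := @ltz_pmod (u - (X s.-1 - b%:Z)) b%:Z ltac:(lia).
have Xt0 := cfX_gt0 e L L_gt0 e_ge2 t tL.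
have [v1|v1] := lerP 0 (v + k * a%:Z).
  have [||j [jL nj uj vj]] := irr_point n (u - k * b%:Z) (v + k * a%:Z) nI _ v1.
  - lia.
  - by rewrite E; ring.
  exists j; split=> //; apply/andP; split.
    have : X j < X s.-1 by lia.
    by rewrite (cfX_lt e L) //; lia.
  rewrite leqNgt -(cfX_lt e L) //; lia.
(* Otherwise reduce v into [0, a), which gives j <= t because a <= Y_(t+1). This shifts u below its
   previous value, so u < X_(s-1) still holds. *)
pose l := (v %/ a%:Z)%Z.
have lE := divz_eq v a%:Z; rewrite -/l in lE.
have q0 := @modz_ge0 v a%:Z ltac:(lia).
have qa := @ltz_pmod v a%:Z ltac:(lia).
have l0 : 0 <= l by nia.
have kl : k < - l by nia.
have [|||j [jL nj uj vj]] := irr_point n (u + l * b%:Z) (v - l * a%:Z) nI.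
- nia.
- lia.
- by rewrite E; ring.
exists j; split=> //; apply/andP; split.
  have : X j < X s.-1 by nia.
  by rewrite (cfX_lt e L) //; lia.
have : Y j < Y t.+1 by lia.
by rewrite (cfY_lt e L).
Qed.

(** Converse of [irr_window]: the irreducibles fill an interval of indices, and the inequalities of
    the criterion hold at its ends. *)
Lemma irr_interval : (a < c)%N -> (b < c)%N -> (exists n, Irr S n) ->
  exists s t, [/\ (0 < s <= t)%N /\ (t < L)%N, a%:Z <= Y t.+1,
    X s < X t + b%:Z <= X s.-1,
    forall n, Irr S n <-> exists j, (s <= j <= t)%N /\ n%:Z = w j
  & forall i j, (s <= i <= t)%N -> (s <= j <= t)%N -> w i = w j -> i = j].
Proof.
move=> ac bc [n0 n0I]; have c0 := quot_c_gt0.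
have Y00 : Y 0%N = 0 by [].
pose T j := (0 < j <= L)%N /\ Irr S (absz (w j)).
have irrT n j : Irr S n -> (j <= L)%N -> n%:Z = w j -> 0 < Y j -> T j.
  move=> nI jL nj Yj; split; last by rewrite -nj.
  by rewrite jL andbT lt0n; apply/negP => /eqP j0; rewrite j0 Y00 in Yj.
have rep1 n : Irr S n -> exists j, [/\ T j, n%:Z = w j & Y j <= a%:Z].
  move=> nI; have [Sn _ _] := nI.
  have [u [v [u0 v0 E]]] := proj1 (semigroup_quotP a b c n) Sn.
  have uv : 0 < v \/ v = 0 /\ b%:Z <= u.
    have [v00|] := eqVneq v 0; last by left; lia.
    right; split=> //; have [j [jL _ -> vj]] := irr_point n u v nI u0 v0 E.
    have [->|j0] := posnP j; first by rewrite cfX0 -cE; lia.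
    by have := cfY_gt0 e L L_gt0 e_ge2 j ltac:(lia); lia.
  (* Dividing v - 1 rather than v puts the new v in [1, a], hence the index is positive. If v = 0,
     then u = c >= b pays for the one shift upwards. *)
  pose l := ((v - 1) %/ a%:Z)%Z.
  have lE := divz_eq (v - 1) a%:Z; rewrite -/l in lE.
  have q0 := @modz_ge0 (v - 1) a%:Z ltac:(lia).
  have qa := @ltz_pmod (v - 1) a%:Z ltac:(lia).
  have [|||j [jL nj uj vj]] := irr_point n (u + l * b%:Z) (v - l * a%:Z) nI.
  - case: uv => [v1|[v1 bu]].
      by have : 0 <= l; nia.
    by have : l = -1; nia.
  - lia.
  - by rewrite E; ring.
  by exists j; split=> //; [apply: (irrT n) => //; lia | lia].
have exT : exists j, `[< T j /\ Y j <= a%:Z >].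
  by have [j [Tj _ Yj]] := rep1 n0 n0I; exists j; apply/asboolP.
have bT : forall j, `[< T j /\ Y j <= a%:Z >] -> (j <= L)%N.
  by move=> j /asboolP[[]]; lia.
case: (ex_maxnP exT bT) => t /asboolP[[t0 tI] Yta] tmax.
have tL : (t < L)%N by rewrite -(cfY_lt e L) -?cE //; lia.
have Xt0 := cfX_gt0 e L L_gt0 e_ge2 t tL.
have rep2 n : Irr S n -> exists j,
    [/\ T j, (j <= t)%N, n%:Z = w j & X j < X t + b%:Z].
  move=> nI; have [i [Ti ni Yi]] := rep1 n nI.
  have it : (i <= t)%N by apply: tmax; apply/asboolP.
  have iL : (i <= L)%N by lia.
  have Yi0 : 0 < Y i by case: Ti => Ti _; apply: (cfY_gt0 e L).
  have Xit : X t <= X i by rewrite leNgt (cfX_lt e L) //; lia.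
  have := quot_point i iL; rewrite -ni => E.
  (* Reduce u into [X_t, X_t + b); v can only grow. *)
  pose l := ((X i - X t) %/ b%:Z)%Z.
  have lE := divz_eq (X i - X t) b%:Z; rewrite -/l in lE.
  have q0 := @modz_ge0 (X i - X t) b%:Z ltac:(lia).
  have qa := @ltz_pmod (X i - X t) b%:Z ltac:(lia).
  have l0 : 0 <= l by nia.
  have [|||j [jL nj uj vj]] :=
    irr_point n (X i - l * b%:Z) (Y i + l * a%:Z) nI.
  - lia.
  - nia.
  - by rewrite E; ring.
  exists j; split=> //; first by apply: (irrT n) => //; nia.
    by rewrite leqNgt -(cfX_lt e L) //; lia.
  lia.
have exs : exists j, `[< [/\ T j, (j <= t)%N & X j < X t + b%:Z] >].
  by exists t; apply/asboolP; split=> //; lia.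
case: (ex_minnP exs) => s /asboolP[[s0 sI] st Xsb] smin.
have rep3 n : Irr S n -> exists j, (s <= j <= t)%N /\ n%:Z = w j.
  move=> nI; have [j [Tj jt nj Xj]] := rep2 n nI; exists j; split=> //.
  by rewrite jt andbT; apply: smin; apply/asboolP.
have sL : (s <= L)%N by lia.
have Ys0 : 0 < Y s := cfY_gt0 e L L_gt0 e_ge2 s ltac:(lia).
have XYj j : (s <= j <= t)%N ->
    [/\ (j <= L)%N, X t <= X j <= X s & Y s <= Y j <= Y t].
  move=> jst; split; first lia.
    by rewrite !leNgt !(cfX_lt e L) //; lia.
  by rewrite !leNgt !(cfY_lt e L) //; lia.
(* True for irreducibles, whose indices lie in [s, t], and preserved by sums since X_t and Y_s are
   nonnegative. *)
have big n : S n -> n <> 0%N -> exists u v : int,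
    [/\ c%:Z * n%:Z = u * a%:Z + v * b%:Z, X t <= u & Y s <= v].
  move: n; apply: Irr_ind => [n /rep3[j [jst nj]]|
    y z [u [v [E Xu Yv]]] [u' [v' [E' Xu' Yv']]]].
    have [jL Xj Yj] := XYj j jst.
    by exists (X j), (Y j); split; [rewrite nj quot_point | lia | lia].
  exists (u + u'), (v + v'); split; lia.
have wS j : (j <= L)%N -> S (absz (w j)) /\ absz (w j) <> 0%N.
  move=> jL; have := quot_point_gt0 j jL => wj0; split; last lia.
  apply/semigroup_quotP; exists (X j), (Y j).
  split; last by rewrite -quot_point; lia.
    exact: (cfX_ge0 e L).
  exact: (cfY_ge0 e L).
have shift j n u v : (j <= L)%N -> n = w j ->
    c%:Z * n = u * a%:Z + v * b%:Z ->
    exists k, u = X j - k * b%:Z /\ v = Y j + k * a%:Z.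
  by move=> jL -> E; apply: quot_shift; rewrite -E quot_point.
exists s, t; split.
- by lia.
(* The representation given by [big] has u >= X_t > X_(t+1), so at least one multiple of a was taken
   from Y_(t+1). The case of index s - 1 is symmetric. *)
- have [Sn n1] := wS t.+1 tL; have [u [v [E Xu Yv]]] := big _ Sn n1.
  have w0 := quot_point_gt0 t.+1 tL.
  have [|k [uE vE]] := shift t.+1 _ u v tL _ E; first by lia.
  have := cfX_ltn e L L_gt0 e_ge2 t t.+1 ltac:(lia) => Xtt.
  have : k < 0 by nia.
  nia.
- rewrite Xsb /=.
  have sL' : (s.-1 <= L)%N by lia.
  have [Sn n1] := wS s.-1 sL'; have [u [v [E Xu Yv]]] := big _ Sn n1.
  have w0 := quot_point_gt0 s.-1 sL'.
  have [|k [uE vE]] := shift s.-1 _ u v sL' _ E; first by lia.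
  have := cfY_ltn e L L_gt0 e_ge2 s.-1 s ltac:(lia) => Yss.
  have : 0 < k by nia.
  nia.
- move=> n; split=> [/rep3 //|[j [jst nj]]].
  have [jL /andP[Xj1 Xj2] /andP[Yj1 Yj2]] := XYj j jst.
  have nw : n = absz (w j) by lia.
  have [Sn n1] := wS j jL; rewrite -nw in Sn n1; split=> // y z Sy Sz nE.
  have [|y0] := eqVneq y 0%N; first by left.
  have [|z0] := eqVneq z 0%N; first by right.
  have [u [v [E Xu Yv]]] := big y Sy ltac:(lia).
  have [u' [v' [E' Xu' Yv']]] := big z Sz ltac:(lia).
  have [|k [uE vE]] := shift j n%:Z (u + u') (v + v') jL nj.
    by rewrite nE PoszD mulrDr E E'; ring.
  (* A shift k < 0 contradicts Y_j <= Y_t <= a, and k > 0 contradicts X_j <= X_s < X_t + b. For k =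
     0, a fan point below (u, v) would be smaller than the point j in both coordinates. *)
  case: (ltrgtP k 0) => k0; [nia | nia |].
  rewrite k0 !mul0r subr0 addr0 in uE vE.
  have := fan_dominates e L L_gt0 e_ge2 u v ltac:(lia) ltac:(lia) ltac:(lia)
    (quot_dvd _ _ _ E).
  case=> i [iL Xi Yi].
  have : X i < X j by lia.
  have : Y i < Y j by lia.
  by rewrite (cfX_lt e L) // (cfY_lt e L) //; lia.
- move=> i j ist jst wij.
  have [iL Xi Yi] := XYj i ist; have [jL Xj Yj] := XYj j jst.
  have [k [XE YE]] := shift j _ _ _ jL wij (quot_point i iL).
  have k0 : k = 0 by nia.
  rewrite k0 mul0r subr0 in XE.
  case: (ltngtP i j) => // ij.
    by have := cfX_ltn e L L_gt0 e_ge2 i j ltac:(lia); rewrite XE ltxx.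
  by have := cfX_ltn e L L_gt0 e_ge2 j i ltac:(lia); rewrite XE ltxx.
Qed.

End Quotient.

(** * Extensions of a modular-convex sequence *)

(** A reducible n in [J] would be a sum of irreducibles, all of them in [J] and different from n,
    against independence. *)
Lemma Irr_eq (S J : set nat) :
  (forall n, Irr S n -> J n) -> (forall n, J n -> S n /\ n <> 0%N) ->
  N_independent J -> Irr S = J.
Proof.
move=> IJ JS Jind; apply/seteqP; split=> // n Jn.
have [//|nI] := pselect (Irr S n); case: (Jind n Jn).
have [Sn n0] := JS n Jn.
apply: (Irr_ind S (smallest submonoid (J `\ n))) Sn n0 => [k kI|y z sy sz].
  move=> M [_]; apply; split; first exact: IJ.
  by move=> kn; apply: nI; rewrite -kn.
by move=> M MM; have [[_ MD] _] := MM; apply: MD; [apply: sy | apply: sz].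
Qed.

Lemma mc_enumerationP (J : set nat) (r : nat) (n : int -> int) :
  mc_enumeration J r n ->
  forall k, J k <-> exists j : nat, (j <= r)%N /\ k%:Z = n j%:Z.
Proof.
move=> [_ [nJ _ nS] _ _ _] k; split=> [Jk|[j [jr kE]]].
  have [|i ir iE] := nS k%:Z; first by exists k.
  move: ir => /= ir; exists (absz i).
  by split; [lia | rewrite -iE; congr n; lia].
have [|k' Jk'] := nJ j%:Z; first by rewrite /=; lia.
by rewrite -kE => -[<-].
Qed.

Section Extension.
Variables (r s L : nat) (nu rho : int) (N D : int -> int).
Hypotheses (s_gt0 : (0 < s)%N) (srL : (s + r < L)%N).
Hypotheses (nuE : nu = - s%:Z) (rhoE : rho = nu + L%:Z).
Hypothesis ND : recurrence nu rho N D.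

(** Moves [nu] to 0; the terms n_0 and n_r then have indices s and s + r. *)
Definition from_index (D : int -> int) (nu : int) (j : nat) : int :=
  D (nu + j%:Z).

Notation e := (from_index D nu).
Notation w := (from_index N nu).

Lemma ext_e_ge2 j : (0 < j < L)%N -> 2 <= e j.
Proof. by move=> jL; have [|] := ND (nu + j%:Z); first by lia. Qed.

Lemma ext_wE j : (0 < j < L)%N -> w j.+1 = e j * w j - w j.-1.
Proof.
move=> jL; have [|_] := ND (nu + j%:Z); first by lia.
have -> : nu + j%:Z + 1 = nu + j.+1%:Z by lia.
by have -> : nu + j%:Z - 1 = nu + j.-1%:Z by lia.
Qed.

Lemma ext_bE : ext_b D N nu rho = w L /\ N rho = w L.
Proof.
split; last by rewrite rhoE.
rewrite /ext_b rhoE (ext_dE D nu L) ?(ext_mE D nu L);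
  try lia; try exact: ext_e_ge2.
by rewrite (fan_last e L w ext_wE) /from_index addr0.
Qed.

Lemma ext_d_fan : ext_d D nu rho = cfY e L.
Proof. by rewrite rhoE (ext_dE D nu L) //; [exact: ext_e_ge2 | lia]. Qed.

Lemma criterionE : criterion r nu rho N D <->
  [/\ gcdz (w 0%N) (w L) = 1, w 0%N <= cfY e (s + r).+1,
      w 0%N < w L < cfY e L
    & cfX e L s < cfX e L (s + r) + w L <= cfX e L s.-1].
Proof.
rewrite /criterion /ext_a (proj1 ext_bE) ext_d_fan.
have -> : N nu = w 0%N by rewrite /from_index addr0.
have -> : cf_q D nu r = cfY e (s + r).+1.
  rewrite -(cf_qE D nu L ext_e_ge2) //; congr cf_q; lia.
have xE (j : nat) (i : int) : (j <= L)%N -> i = nu + j%:Z ->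
    ext_x D nu rho i = cfX e L j.
  by move=> jL ->; rewrite rhoE (ext_xE D nu L) //; [exact: ext_e_ge2 | lia].
by rewrite (xE s 0) ?(xE (s + r)%N r%:Z) ?(xE s.-1 (-1)); try lia.
Qed.

End Extension.

(** * Sufficiency of the criterion *)

Lemma Irr_of_criterion (J : set nat) (r : nat) (n d : int -> int)
    (nu rho : int) (N D : int -> int) :
  N_independent J -> mc_enumeration J r n ->
  nu < 0 -> r%:Z < rho -> extension r n d nu rho N D ->
  N rho = ext_b D N nu rho /\
  (criterion r nu rho N D ->
   Irr (semigroup_quot
          (semigroup2 (absz (ext_a N nu)) (absz (ext_b D N nu rho)))
          (absz (ext_d D nu rho))) = J).
Proof.
move=> Jind Jn nu0 rrho [_ Nn ND _ Npos].
pose s := absz nu; pose L := absz (rho - nu)%R.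
have s0 : (0 < s)%N by lia.
have srL : (s + r < L)%N by lia.
have nuE : nu = - s%:Z by lia.
have rhoE : rho = nu + L%:Z by lia.
have [bE NE] := ext_bE r s L nu rho N D s0 srL nuE rhoE ND.
split; first by rewrite bE.
move/(criterionE r s L nu rho N D s0 srL nuE rhoE ND).
have dE := ext_d_fan r s L nu rho N D s0 srL nuE rhoE ND.
pose e := from_index D nu; pose w := from_index N nu.
have aE : ext_a N nu = w 0%N by rewrite /w /from_index addr0.
rewrite bE dE aE -/e -/w => -[gab aq _ /andP[_ xx]].
have L0 : (0 < L)%N by lia.
have e2 := ext_e_ge2 r s L nu rho N D s0 srL nuE rhoE ND.
have wE := ext_wE r s L nu rho N D s0 srL nuE rhoE ND.
have wpos j : (j <= L)%N -> 0 < w j by move=> jL; apply: Npos; lia.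
have dpos := cf_dd_gt0 e L L0 e2.
have a0 := wpos 0%N ltac:(lia); have b0 := wpos L ltac:(lia).
have cop_ab : coprime (absz (w 0%N)) (absz (w L)).
  by move: gab => /eqP.
have [cop_ac _] := coprime_last e L (w 0%N) (w L) (w 1%N)
   (fan_last e L w wE) cop_ab.
have aE' : (absz (w 0%N))%:Z = w 0%N by lia.
have bE' : (absz (w L))%:Z = w L by lia.
have cE' : (absz (cfY e L))%:Z = cfY e L by lia.
have Jw k : J k <-> exists j, (s <= j <= s + r)%N /\ k%:Z = w j.
  rewrite (mc_enumerationP _ _ _ Jn); split=> -[j [jr kE]].
    exists (s + j)%N; split; first lia.
    by rewrite kE -Nn /w /from_index; [congr N; lia | lia].
  exists (j - s)%N; split; first lia.
  by rewrite kE -Nn /w /from_index; [congr N; lia | lia].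
(* [irr_window] with t = s + r puts the irreducibles in [J]; conversely, the fan points represent
   the elements of [J]. *)
apply: Irr_eq => // k.
  move=> kI; apply/Jw.
  apply: (irr_window e L _ _ _ w L0 e2 wE _ _ aE' bE' cE') kI => //; lia.
move/Jw=> [j [jr kE]]; have jL : (j <= L)%N by lia.
have wj := wpos j jL; split; last lia.
apply: (proj2 (semigroup_quotP _ _ _ _)); exists (cfX e L j), (cfY e j); split.
- exact: (cfX_ge0 e L).
- exact: (cfY_ge0 e L).
- by rewrite kE aE' bE' cE'; apply: fan_point.
Qed.

(** * Every solution comes from an extension *)

Lemma coprimez_lrec (e : nat -> int) (L : nat) (w : nat -> int) :
  (forall j, (0 < j < L)%N -> w j.+1 = e j * w j - w j.-1) ->
  coprimez (w 0%N) (w 1%N) -> forall j, (j < L)%N -> coprimez (w j) (w j.+1).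
Proof.
move=> wE w01; elim=> [//|j IHj] jL.
have /coprimezP[[x y] /= xy] := IHj (ltnW jL).
apply/coprimezP; exists (x * e j.+1 + y, - x) => /=.
by rewrite (wE j.+1) ?jL //= -xy; ring.
Qed.

(** Both sequences list [J] without repetition, so their lengths r + 1 and t - s + 1 agree. *)
Lemma mc_enumeration_card (J : set nat) (r s t : nat) (n : int -> int)
    (w : nat -> int) :
  mc_enumeration J r n -> (s <= t)%N ->
  (forall j, (s <= j <= t)%N -> 0 < w j) ->
  (forall k, J k <-> exists j, (s <= j <= t)%N /\ k%:Z = w j) ->
  (forall i j, (s <= i <= t)%N -> (s <= j <= t)%N -> w i = w j -> i = j) ->
  t = (s + r)%N.
Proof.
move=> Jn st w0 Jw wI; have nP := mc_enumerationP _ _ _ Jn.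
have [_ [_ nI _] n0 _ _] := Jn.
pose l1 := [seq absz (n j%:Z) | j <- iota 0 r.+1].
pose l2 := [seq absz (w j) | j <- iota s (t - s).+1].
have u1 : uniq l1.
  rewrite map_inj_in_uniq ?iota_uniq // => i j; rewrite !mem_iota => ir jr ij.
  have i0 := n0 i%:Z ltac:(lia); have j0 := n0 j%:Z ltac:(lia).
  by have [] : i%:Z = j%:Z by apply: nI; rewrite ?inE /=; lia.
have u2 : uniq l2.
  rewrite map_inj_in_uniq ?iota_uniq // => i j; rewrite !mem_iota => ir jr ij.
  have i0 := w0 i ltac:(lia); have j0 := w0 j ltac:(lia).
  by apply: wI; lia.
have m1 x : reflect (J x) (x \in l1).
  apply: (iffP mapP) => [[j]|/nP[j [jr xj]]].
    rewrite mem_iota => jr ->; apply/nP; exists j; split; first lia.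
    by have := n0 j%:Z ltac:(lia); lia.
  by exists j; [rewrite mem_iota; lia | lia].
have m2 x : reflect (J x) (x \in l2).
  apply: (iffP mapP) => [[j]|/Jw[j [jr xj]]].
    rewrite mem_iota => jr ->; apply/Jw; exists j; split; first lia.
    by have := w0 j ltac:(lia); lia.
  by exists j; [rewrite mem_iota; lia | lia].
have : perm_eq l1 l2 by apply: uniq_perm => // x; apply/m1/m2.
by move/perm_size; rewrite !size_map !size_iota; lia.
Qed.

(** m is the residue of -b x, where the Bezout coefficient x inverts a modulo c. *)
Lemma exists_opp_residue (a b c : nat) : (0 < c)%N -> coprime a c ->
  exists (m : nat) (w1 : int), (m < c)%N /\ c%:Z * w1 = m%:Z * a%:Z + b%:Z.
Proof.
move=> c0 ac; have /coprimezP[[x y] /= xy] : coprimez a c by [].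
pose q := ((- b%:Z * x) %/ c%:Z)%Z.
have qE := divz_eq (- b%:Z * x) c%:Z; rewrite -/q in qE.
have r0 := @modz_ge0 (- b%:Z * x) c%:Z ltac:(lia).
have rc := @ltz_pmod (- b%:Z * x) c%:Z ltac:(lia).
move: ((- b%:Z * x) %% c%:Z)%Z qE r0 rc => m qE r0 rc.
exists (absz m), (b%:Z * y - q * a%:Z); split; first lia.
rewrite gez0_abs //; have -> : m = - b%:Z * x - q * c%:Z by lia.
have yc : y * c%:Z = 1 - x * a%:Z by rewrite -xy; ring.
transitivity (b%:Z * (y * c%:Z) - q * a%:Z * c%:Z); first by ring.
by rewrite yc; ring.
Qed.

(** The enumeration is read off the fan of the given triple, hence the existential [n'] and [d']. *)
Lemma solution_obtained (J : set nat) (r : nat) (n : int -> int) (a b c : nat) :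
  mc_enumeration J r n -> is_solution J a b c ->
  exists (n' d' : int -> int) (nu rho : int),
    [/\ mc_enumeration J r n', recurrence 0 r%:Z n' d',
        nu < 0, r%:Z < rho & obtained r n' d' nu rho a b c].
Proof.
move=> Jn [[a0 b0 c0] [cab cac cbc] /andP[ab bc] SJ].
have [m [w1 [mc w1E]]] := exists_opp_residue a b c c0 cac.
have cmc : coprime m c.
  have /coprimezP[[x y] /= xy] : coprimez b c by [].
  have : coprimez m c by apply/coprimezP; exists (- x * a%:Z, x * w1 + y) => /=;
    rewrite -xy; have -> : b%:Z = c%:Z * w1 - m%:Z * a%:Z; [lia | ring].
  by [].
have [e [L [L0 e2 YE PE]]] := ceil_cf_expansion m c mc cmc.
(* The solution of the recurrence starting with a and w1; it ends with c w1 - m a = b. *)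
pose w j := cfY e j * w1 - cfP e j * a%:Z.
have wE j : (0 < j < L)%N -> w j.+1 = e j * w j - w j.-1.
  by case: j => [//|j] _; rewrite /w cfYSS cfPSS /=; ring.
have aE : a%:Z = w 0%N by rewrite /w /cfY /cfP /=; ring.
have bE : b%:Z = w L by rewrite /w YE PE; lia.
have wpos := quot_point_gt0 e L a b c w L0 e2 wE a0 b0 aE bE (esym YE) cab cac.
have nP := mc_enumerationP _ _ _ Jn.
have [|||s [t [[st tL] aY Xst Iw wI]]] :=
  irr_interval e L a b c w L0 e2 wE a0 b0 aE bE (esym YE) cab cac.
- lia.
- lia.
- rewrite SJ; have [_ _ n0 _ _] := Jn; exists (absz (n 0%N%:Z)); apply/nP.
  by exists 0%N; split=> //; have := n0 0%N%:Z ltac:(lia); lia.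
rewrite SJ in Iw.
have tE : t = (s + r)%N.
  apply: (mc_enumeration_card J r s t n w) => //; first by lia.
  by move=> j jst; apply: wpos; lia.
have [r0 _ _ _ _] := Jn.
pose N (i : int) := w (absz (i + s%:Z)%R).
pose D (i : int) := e (absz (i + s%:Z)%R).
pose nu := - s%:Z; pose rho := nu + L%:Z.
have ND : recurrence nu rho N D.
  move=> i irho; split; first by apply: e2; lia.
  have -> : N (i + 1) = w (absz (i + s%:Z)%R).+1 by rewrite /N; congr w; lia.
  have -> : N (i - 1) = w (absz (i + s%:Z)%R).-1 by rewrite /N; congr w; lia.
  by apply: wE; lia.
have Npos i : nu <= i <= rho -> 0 < N i by move=> irho; apply: wpos; lia.
have Nconv : modular_convex nu rho N.
  move=> i irho; have [D2 ->] := ND i irho.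
  by exists (D i - 2); [lia | ring].
have recsub lo hi : nu <= lo -> hi <= rho -> recurrence lo hi N D.
  by move=> lo_ge hi_le i ilh; apply: ND; lia.
have NJ (i : int) : 0 <= i <= r%:Z ->
    exists j, [/\ (s <= j <= t)%N, N i = w j & i = j%:Z - s%:Z].
  by move=> ir; exists (absz (i + s%:Z)%R); split=> //; lia.
exists N, D, nu, rho; split.
- split=> //.
  + split.
    * move=> i /= /NJ[j [jst NE _]]; exists (absz (N i)).
        by apply/Iw; exists j; rewrite -NE; have := wpos j ltac:(lia); lia.
      by have := wpos j ltac:(lia); lia.
    * move=> i k; rewrite !inE /=.
      move=> /NJ[j [jst -> iE]] /NJ[j' [jst' -> kE]] wjj.
      by have := wI j j' jst jst' wjj; lia.
    * move=> _ [k /Iw[j [jst kE]] <-]; exists (j%:Z - s%:Z) => /=; first lia.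
      by rewrite kE /N; congr w; lia.
  + by move=> i ir; apply: Npos; lia.
  + by move=> i ir; apply: Nconv; lia.
  + apply/eqP; have -> : N 0 = w s by [].
    have -> : N 1 = w s.+1 by [].
    apply: (coprimez_lrec e L w wE); last lia.
    have /coprimezP[[x y] /= xy] : coprimez a b by [].
    apply/coprimezP; exists (x - y * m%:Z, y * c%:Z); rewrite -aE /=.
    have -> : w 1%N = w1 by rewrite /w /cfY /cfP /=; ring.
    have -> : y * c%:Z * w1 = y * (m%:Z * a%:Z + b%:Z) by rewrite -mulrA w1E.
    by rewrite -xy; ring.
- by apply: recsub; lia.
- by lia.
- by lia.
- exists N, D.
  have s0 : (0 < s)%N by lia.
  have srL : (s + r < L)%N by lia.
  have extw j : from_index N nu j = w j by rewrite /from_index /N; congr w; lia.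
  have exte : from_index D nu = e.
    by apply/funext => j; rewrite /from_index /D; congr e; lia.
  split=> //.
  + apply/(criterionE r s L nu rho N D s0 srL erefl erefl ND).
    rewrite exte !extw -aE -bE -tE YE; split=> //; last lia.
    by apply/eqP.
  + rewrite (ext_d_fan r s L nu rho N D s0 srL erefl erefl ND) exte YE.
    rewrite (proj1 (ext_bE r s L nu rho N D s0 srL erefl erefl ND)) extw -bE.
    by rewrite aE -extw /from_index addr0.
Qed.

(** * Infinitely many solutions *)

Lemma exists_coprime_shift (p q a : nat) :
  coprime p q -> (0 < q)%N -> (0 < a)%N -> exists t, coprime (t * p + q) a.
Proof.
(* [t] is the largest divisor of a prime to q. A prime dividing a and t p + q cannot divide q, since
   t and p are prime to q; so it divides t, and then q after all. *)
move=> cpq q0 a0; exists (a`_(\pi(q)^'))%N; set t := (a`_ _)%N.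
have ctq : coprime t q := p'nat_coprime (part_pnat _ _) (pnat_pi q0).
apply/negPn/negP; rewrite /coprime => gN.
have g0 : (0 < gcdn (t * p + q) a)%N by rewrite gcdn_gt0 a0 orbT.
have g1 : (1 < gcdn (t * p + q) a)%N by lia.
have := pdiv_prime g1; have := pdiv_dvd (gcdn (t * p + q) a).
move: (pdiv _) => l; rewrite dvdn_gcd => /andP[ltpq la] lpr.
have l_coprime x y : coprime x y -> (l %| x)%N -> (l %| y)%N -> False.
  move=> /eqP xy lx ly; have : (l %| gcdn x y)%N by rewrite dvdn_gcd lx ly.
  by rewrite xy dvdn1 => /eqP l1; rewrite l1 in lpr.
have [lq|lq] := boolP (l %| q)%N.
  have : (l %| t * p)%N by rewrite -(dvdn_addl _ lq).
  rewrite Euclid_dvdM // => /orP[lt|lp].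
    exact: (l_coprime t q).
  exact: (l_coprime p q).
have lt : (l %| t)%N.
  rewrite -(@part_pnat_id (\pi(q)^') l); first exact: partn_dvd.
  by rewrite pnatE // inE /= mem_primes lpr q0.
by move: ltpq; rewrite dvdn_addr ?dvdn_mulr // (negPf lq).
Qed.

Lemma recurrence_lrec (r : nat) (n d : int -> int) : recurrence 0 r%:Z n d ->
  forall j, (0 < j < r)%N ->
    2 <= d j%:Z /\ n j.+1%:Z = d j%:Z * n j%:Z - n j.-1%:Z.
Proof.
move=> nd j jr; have [|d2 nE] := nd j%:Z; first by lia.
split=> //; have -> : j.+1%:Z = j%:Z + 1 by lia.
by rewrite nE; congr (_ - n _); lia.
Qed.

(* Otherwise [(K - n_r, n_0)], where [K = cfY d r], is a point of the lattice
   with the same value [n_0] as [(K, 0)], so [n_0] is a combination of the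
   [n_j] with [j > 0]. *)
Lemma independent_last_gt (J : set nat) (r : nat) (n d : int -> int) :
  N_independent J -> mc_enumeration J r n -> recurrence 0 r%:Z n d ->
  cfY (fun j => d j%:Z) r < n r%:Z.
Proof.
move=> Jind Jn nd; rewrite ltNge; apply/negP => nrK.
have nP := mc_enumerationP _ _ _ Jn; have [r0 [_ nI _] n0 _ _] := Jn.
have ndj := recurrence_lrec r n d nd.
pose e j := d j%:Z; pose w j := n j%:Z.
have e2 j : (0 < j < r)%N -> 2 <= e j by case/ndj.
have wE j : (0 < j < r)%N -> w j.+1 = e j * w j - w j.-1 by case/ndj.
have wpos j : (j <= r)%N -> 0 < w j by move=> jr; apply: n0; lia.
have w0 := wpos 0%N isT; have wr := wpos r (leqnn r).
have J0 : J (absz (w 0%N)) by apply/nP; exists 0%N; rewrite gtz0_abs.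
apply: (Jind _ J0) => M [[M0 MD] JM].
pose Q (x : int) := 0 <= x /\ M (absz x).
suff [] : Q (w 0%N) by [].
apply: (fan_generates e r r0 e2 w wE Q (cfY e r - w r) _ _ _
         (cfY e r - w r) (w 0%N)).
- by split.
- move=> x y [x0 Mx] [y0 My]; split; first lia.
  have -> : absz (x + y)%R = (absz x + absz y)%N by lia.
  exact: MD.
- move=> j jr Xj; have wj := wpos j jr; split; first lia.
  (* Index 0 is excluded because X_0 = K exceeds K - n_r. *)
  have j0 : (0 < j)%N.
    by rewrite lt0n; apply/negP => /eqP j0; move: Xj; rewrite j0 cfX0; lia.
  apply: JM; split; first by apply/nP; exists j; rewrite gtz0_abs.
  move=> jE; have [] : j%:Z = 0%N%:Z; last by lia.
  have wj0 : w j = w 0%N by move: jE => /= jE; lia.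
  by apply: nI => //; rewrite inE /=; lia.
- by rewrite subr_ge0 nrK lexx.
- lia.
- rewrite (fan_last e r w wE); apply/dvdzP; exists (1 - w 1%N); ring.
- by ring.
Qed.


Lemma solution_unbounded (J : set nat) (r : nat) (n d : int -> int) (k : nat) :
  N_independent J -> mc_enumeration J r n -> recurrence 0 r%:Z n d ->
  exists a b c : nat, [/\ is_solution J a b c,
    obtained r n d (-1) (r%:Z + 1) a b c & (k <= b)%N].
Proof.
move=> Jind Jn nd; have Kn := independent_last_gt J r n d Jind Jn nd.
have [r0 _ n0 _ n01] := Jn; have ndj := recurrence_lrec r n d nd.
pose w j := n j%:Z.
have wpos j : (j <= r)%N -> 0 < w j by move=> jr; apply: n0; lia.
have cop_w j : (j < r)%N -> coprimez (w j) (w j.+1).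
  apply: (coprimez_lrec (fun j => d j%:Z) r w); first by move=> i /ndj[].
  by apply/eqP.
have w0 := wpos 0%N isT; have w1 := wpos 1%N r0; have wr := wpos r (leqnn r).
have wr1 := wpos r.-1 ltac:(lia).
(* [A] will be D_0: the summand w_1 makes a positive, and w_r makes d exceed b. *)
pose A : int := w 1%N + w r + 2; pose a : int := A * w 0%N - w 1%N.
have a0 : 0 < a by rewrite /a /A; nia.
(* The coefficients that precede D_r, so that the size of D_r can be chosen in terms of
   [cfY e0 r]. *)
pose e0 (j : nat) : int := if (j <= 1)%N then A else d j.-1%:Z.
have [t0 t0P] : exists t0 : nat, coprimez (t0%:Z * w r + w r.-1) a.
  have [|||t0 ct] := exists_coprime_shift (absz (w r)) (absz (w r.-1)) (absz a).
  - have := cop_w r.-1 ltac:(lia); rewrite prednK // /coprimez gcdzC.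
    by rewrite -/(coprimez _ _).
  - lia.
  - lia.
  exists t0; move: ct; rewrite -[coprime _ _]/(coprimez (Posz _) (Posz _)).
  by rewrite PoszD PoszM !gtz0_abs.
(* [t] will be D_r. Being -t0 modulo a, it makes b = -(t0 w_r + w_(r-1)) mod a, prime to a; [T] is
   large enough for all the inequalities below. *)
pose T : int := t0%:Z + k%:Z + A * w 0%N + w r.-1 + `|cfY e0 r| + 2.
pose t : int := a * T - t0%:Z.
have Aw0 : 0 < A * w 0%N by rewrite /A; nia.
have tT : k%:Z + A * w 0%N + w r.-1 + `|cfY e0 r| + 2 <= t.
  have : T <= a * T by rewrite /T; nia.
  by rewrite /t /T; lia.
pose b : int := t * w r - w r.-1.
have cab : coprimez a b.
  case/coprimezP: t0P => -[x y] /= xy.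
  apply/coprimezP; exists (y + x * T * w r, - x) => /=.
  by rewrite -xy /b /t; ring.
pose N (i : int) : int :=
  if i == -1 then a else if i == r%:Z + 1 then b else n i.
pose D (i : int) : int := if i == 0 then A else if i == r%:Z then t else d i.
have NE (i : int) : 0 <= i <= r%:Z -> N i = n i.
  move=> ir; rewrite /N; have -> : (i == -1) = false by lia.
  by have -> : (i == r%:Z + 1) = false by lia.
have Nm1 : N (-1) = a by rewrite /N eqxx.
have Nr1 : N (r%:Z + 1) = b.
  by rewrite /N eqxx; have -> : (r%:Z + 1 == -1) = false by lia.
have ND : recurrence (-1) (r%:Z + 1) N D.
  move=> i ir; rewrite /D; have [i0|i0] := eqVneq i 0.
    rewrite i0 add0r sub0r Nm1 !NE; [|lia|lia].
    by split; [rewrite /A; lia | rewrite /a /w; ring].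
  have [ir'|ir'] := eqVneq i r%:Z.
    rewrite ir' Nr1 !NE; [|lia|lia].
    split; first lia.
    by rewrite /b /w; congr (_ - n _); lia.
  rewrite !NE; try lia.
  by apply: nd; lia.
have Npos i : -1 <= i <= r%:Z + 1 -> 0 < N i.
  move=> ir; have [->|i1] := eqVneq i (-1); first by rewrite Nm1.
  have [->|i2] := eqVneq i (r%:Z + 1); first by rewrite Nr1 /b; nia.
  by rewrite NE ?n0 //; lia.
have ext : extension r n d (-1) (r%:Z + 1) N D.
  split=> //.
  - move=> i ir; rewrite /D; have -> : (i == 0) = false by lia.
    by have -> : (i == r%:Z) = false by lia.
  - move=> i irho; have [D2 ->] := ND i irho.
    by exists (D i - 2); [lia | ring].
have s0 : (0 < 1)%N by [].
have srL : (1 + r < r.+2)%N by lia.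
have rhoE : r%:Z + 1 = -1 + r.+2%:Z by lia.
have bE := ext_bE r 1 r.+2 (-1) (r%:Z + 1) N D s0 srL erefl rhoE ND.
have dE := ext_d_fan r 1 r.+2 (-1) (r%:Z + 1) N D s0 srL erefl rhoE ND.
have crE := criterionE r 1 r.+2 (-1) (r%:Z + 1) N D s0 srL erefl rhoE ND.
have e2 := ext_e_ge2 r 1 r.+2 (-1) (r%:Z + 1) N D s0 srL erefl rhoE ND.
have ewE := ext_wE r 1 r.+2 (-1) (r%:Z + 1) N D s0 srL erefl rhoE ND.
set e := from_index D (-1) in bE dE crE e2 ewE.
set v := from_index N (-1) in bE dE crE e2 ewE.
have v0E : v 0%N = a by rewrite /v /from_index addr0.
have vLE : v r.+2 = b by rewrite -(proj2 bE).
have eD j : e j.+1 = D j%:Z by rewrite /e /from_index; congr D; lia.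
have er : e r.+1 = t.
  by rewrite eD /D eqxx; have -> : (r%:Z == 0) = false by lia.
have ed j : (0 < j < r)%N -> e j.+1 = d j%:Z.
  move=> jr; rewrite eD /D; have -> : (j%:Z == 0) = false by lia.
  by have -> : (j%:Z == r%:Z) = false by lia.
have eE j : (0 < j <= r)%N -> e j = e0 j.
  case: j => [//|[|j]] jr; first by rewrite eD.
  by rewrite ed //; lia.
set c := cfY e r.+2 in dE crE.
have cgt : b < c.
  have Y2 : cfY e 2 = A by rewrite /cfY /= eD /D /=; ring.
  have YA : A <= cfY e r.+1.
    rewrite -Y2; have [<-|r1] := eqVneq 1%N r; first by [].
    by apply: ltW; apply: (cfY_ltn e r.+2) => //; lia.
  have YrE : cfY e r = cfY e0 r by apply: eq_lrec => j jr; apply: eE; lia.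
  by rewrite /c cfYSS er YrE /b; move: YA; rewrite /A; nia.
(* m = t K - [cfP e r] while b = t w_r - w_(r-1); since K < w_r, the difference b - m is at least t
   - w_(r-1). *)
have mle : cfP e r.+2 <= b.
  have PK : cfP e r.+1 = cfY (fun j => d j%:Z) r.
    by rewrite cfPS; apply: eq_lrec => j; apply: ed.
  have P0 : 0 <= cfP e r.
    rewrite -[r in cfP e r](prednK r0) cfPS.
    apply: (@cfY_ge0 _ r) => //; last by lia.
    by move=> j jr; apply: e2; lia.
  by rewrite cfPSS er PK /b; move: Kn; rewrite -/(w r); nia.
have abE : a < b by rewrite /b; nia.
have cr : criterion r (-1) (r%:Z + 1) N D.
  (* Here q_r = x_(-1) = d, x_0 = m and x_r = 1, so the last condition is m < 1 + b <= d. *)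
  apply/crE; rewrite v0E vLE cfXLp // cfX0 cfX1; split=> //.
  - exact/eqP.
  - by apply: ltW; apply: lt_trans cgt.
  - by rewrite abE.
  - lia.
have [_ /(_ cr) SJ] := Irr_of_criterion J r n d (-1) (r%:Z + 1) N D Jind Jn
  ltac:(lia) ltac:(lia) ext.
have baE : b = c * v 1%N - cfP e r.+2 * a by rewrite -vLE -v0E; apply: fan_last.
have [cac cbc] := coprime_last e r.+2 a b (v 1%N) baE cab.
exists (absz a), (absz b), (absz c); split.
- split=> //; first by split; lia.
  + by lia.
  + by move: SJ; rewrite (proj1 bE) dE vLE /ext_a Nm1.
- exists N, D; split=> //.
  by rewrite (proj1 bE) dE vLE /ext_a Nm1; split; lia.
- by rewrite /b; nia.
Qed.

Theorem theorem3 (I : set nat) (r : nat) (n d : int -> int)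
    (I_fin : finite_set I) (I_ge2 : forall k, I k -> (1 < k)%N)
    (I_indep : N_independent I) (n_enum : mc_enumeration I r n)
    (d_spec : recurrence 0 r%:Z n d) :
  [/\ (forall (nu rho : int) (N D : int -> int),
         nu < 0 -> r%:Z < rho -> extension r n d nu rho N D ->
         N rho = ext_b D N nu rho /\
         (criterion r nu rho N D ->
          Irr (semigroup_quot
                 (semigroup2 (absz (ext_a N nu)) (absz (ext_b D N nu rho)))
                 (absz (ext_d D nu rho))) = I)),
      (forall a b c : nat, is_solution I a b c ->
         exists (n' d' : int -> int) (nu rho : int),
           [/\ mc_enumeration I r n', recurrence 0 r%:Z n' d',
               nu < 0, r%:Z < rho & obtained r n' d' nu rho a b c])
    & infinite_set [set t : nat * nat * nat |
        is_solution I t.1.1 t.1.2 t.2 /\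
        obtained r n d (-1) (r%:Z + 1) t.1.1 t.1.2 t.2]].
Proof.
split.
- by move=> nu rho N D; apply: Irr_of_criterion.
- by move=> a b c; apply: solution_obtained n_enum.
(* A finite list of triples bounds b, whereas b can be taken arbitrarily large. *)
- move/finite_seqP=> [s sE].
  have [a [b [c [abc ob kb]]]] :=
    solution_unbounded I r n d (\max_(t <- s) t.1.2).+1 I_indep n_enum d_spec.
  have : [set` s] (a, b, c) by rewrite -sE.
  move=> /= abcs.
  have : (b <= \max_(t <- s) t.1.2)%N by apply: (leq_bigmax_seq (a, b, c)).
  by rewrite leqNgt kb.
Qed.
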